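(* Let $(\mathcal{N},\circ_\lambda)$ be a commutative associative conformal algebra and $D$ a derivation of it. Then $(\mathcal{N},\circ_\lambda,[\cdot_\lambda\cdot])$ is a transposed Poisson conformal algebra, where $$[a_\lambda b]=a\circ_\lambda D(b)-b\circ_{-\partial-\lambda}D(a),\qquad a,b\in\mathcal{N}.$$
   Context: All vector spaces, linear maps and tensor products are over $\mathbb{C}$. For a vector space $A$, $A[\lambda]$ denotes polynomials in $\lambda$ with coefficients in $A$. A conformal algebra $(A,\circ_\lambda)$ is a $\mathbb{C}[\partial]$-module $A$ with a $\mathbb{C}$-bilinear map $A\otimes A\to A[\lambda]$, $a\otimes b\mapsto a\circ_\lambda b$, such that $(\partial a)\circ_\lambda b=-\lambda\, a\circ_\lambda b$ and $a\circ_\lambda(\partial b)=(\partial+\lambda)(a\circ_\lambda b)$. A derivation of $(A,\circ_\lambda)$ is a linear map $D:A\to A$ with $D\partial=\partial D$ and $D(a\circ_\lambda b)=D(a)\circ_\lambda b+a\circ_\lambda D(b)$ for all $a,b\in A$. Convention: products are extended linearly to polynomials in formal variables. If $a\circ_\lambda b=\sum_n\lambda^n w_n$ and $\nu$ is a linear combination of formal variables, then $a\circ_{-\partial+\nu}b=\sum_n(-\partial+\nu)^n w_n$; the same convention applies to $[a_\lambda b]$. A commutative associative conformal algebra is a conformal algebra with $a\circ_\lambda(b\circ_\mu c)=(a\circ_\lambda b)\circ_{\lambda+\mu}c$ and $a\circ_\lambda b=b\circ_{-\partial-\lambda}a$ for all $a,b,c$. A Lie conformal algebra $(A,[\cdot_\lambda\cdot])$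 is a conformal algebra (with product written $[a_\lambda b]$) such that $[a_\lambda b]=-[b_{-\lambda-\partial}a]$ and $[a_\lambda[b_\mu c]]=[[a_\lambda b]_{\lambda+\mu}c]+[b_\mu[a_\lambda c]]$ for all $a,b,c$. A transposed Poisson conformal algebra (TPCA) is a $\mathbb{C}[\partial]$-module $\mathcal{L}$ with $\mathbb{C}$-bilinear maps $\circ_\lambda,[\cdot_\lambda\cdot]:\mathcal{L}\otimes\mathcal{L}\to\mathcal{L}[\lambda]$ such that $(\mathcal{L},\circ_\lambda)$ is a commutative associative conformal algebra, $(\mathcal{L},[\cdot_\lambda\cdot])$ is a Lie conformal algebra, and $2(a\circ_\lambda[b_\mu c])=[(a\circ_\lambda b)_{\lambda+\mu}c]+[b_\mu(a\circ_\lambda c)]$ for all $a,b,c\in\mathcal{L}$. *)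

(* Defs.v *)
From HB Require Import structures.
From mathcomp Require Import all_boot all_order all_algebra.
From mathcomp Require Import finmap.
From mathcomp Require Export sesquilinear reals complex.
From mathcomp Require Export monalg.

Set Implicit Arguments.
Unset Strict Implicit.
Unset Printing Implicit Defensive.

Import GRing.Theory.
Local Open Scope ring_scope.

(* [fpoly K A]: polynomials in formal variables with coefficients in the      *)
(* vector space A, where K is the additive monoid of exponents:               *)
(*   A[lambda]     is fpoly nat A,         with lambda^n ~ n : nat;           *)
(*   A[lambda, mu] is fpoly (nat * nat) A, with lambda^i mu^j ~ (i, j).       *)
(* The coefficient of the monomial k in p is p@_k.                            *)
Definition fpoly (K : nmodType) (A : zmodType) := {malg A[K]}.

HB.instance Definition _ (K : nmodType) (A : zmodType) :=
  GRing.Zmodule.on (fpoly K A).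

(* monalg only provides scaling when the coefficients form a ring. *)
Section FpolyLmodule.
Context (C : nzRingType) (K : nmodType) (A : lmodType C).
Implicit Types (c : C) (p q : fpoly K A).

Definition fpoly_scale c p : fpoly K A := [malg k in msupp p => c *: p@_k].

Lemma fpoly_scaleE c p k : (fpoly_scale c p)@_k = c *: p@_k.
Proof. by rewrite mcoeffE; case: msuppP => // _; rewrite scaler0. Qed.

Lemma fpoly_scaleA c1 c2 p :
  fpoly_scale c1 (fpoly_scale c2 p) = fpoly_scale (c1 * c2) p.
Proof. by apply/malgP => k; rewrite !fpoly_scaleE scalerA. Qed.

Lemma fpoly_scale1 : left_id 1 fpoly_scale.
Proof. by move=> p; apply/malgP => k; rewrite fpoly_scaleE scale1r. Qed.

Lemma fpoly_scaleDr : right_distributive fpoly_scale +%R.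
Proof.
move=> c p q; apply/malgP => k.
by rewrite fpoly_scaleE !mcoeffD !fpoly_scaleE scalerDr.
Qed.

Lemma fpoly_scaleDl p : {morph fpoly_scale^~ p : c1 c2 / c1 + c2}.
Proof.
move=> c1 c2; apply/malgP => k.
by rewrite mcoeffD !fpoly_scaleE scalerDl.
Qed.

HB.instance Definition _ := GRing.Zmodule_isLmodule.Build C (fpoly K A)
  fpoly_scaleA fpoly_scale1 fpoly_scaleDr fpoly_scaleDl.

End FpolyLmodule.

Section FpolyOperations.
Context (K : nmodType) (A : zmodType).
Implicit Types (p : fpoly K A) (a : A).

Definition fconst a : fpoly K A := << a *g (0 : K) >>.

(* Multiplication by the monomial k. *)
Definition fmonom (k : K) p : fpoly K A :=
  \sum_(l <- msupp p) << p@_l *g (k + l : K) >>.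

(* Coefficientwise extension of an additive map A -> A. *)
Definition fmap_coef (f : A -> A) p : fpoly K A :=
  \sum_(l <- msupp p) << f p@_l *g l >>.

(* For w = \sum_n lambda^n w_n, the value \sum_n nu^n w_n, where nu is given  *)
(* as an operator on polynomials (such as multiplication by lambda + mu, or   *)
(* -d - lambda).                                                              *)
Definition fsubst (nu : fpoly K A -> fpoly K A) (w : fpoly nat A) :
    fpoly K A :=
  \sum_(n <- msupp w) iter n nu (fconst w@_n).

(* The product p o_nu q, extended linearly from A to polynomials. *)
Definition lprod (star : A -> A -> fpoly nat A)
    (nu : fpoly K A -> fpoly K A) (p q : fpoly K A) : fpoly K A :=
  \sum_(k <- msupp p) \sum_(l <- msupp q)
    fmonom (k + l) (fsubst nu (star p@_k q@_l)).

End FpolyOperations.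

Arguments fconst {K A} a.

Section Structures.
Context (C : fieldType) (A : lmodType C).
(* The C[d]-module structure of A is given by the action of d. *)
Context (d : {linear A -> A}).
Implicit Types (star circ br : A -> A -> fpoly nat A).

Definition fd {K : nmodType} : fpoly K A -> fpoly K A := fmap_coef d.

Definition lam1 : fpoly nat A -> fpoly nat A := fmonom (1 : nat).

(* -d - lambda, acting on A[lambda] *)
Definition neg_d_lam : fpoly nat A -> fpoly nat A := (\- fd) \- lam1.

Definition lam : fpoly (nat * nat)%type A -> fpoly (nat * nat)%type A :=
  fmonom ((1, 0) : nat * nat).
Definition mu : fpoly (nat * nat)%type A -> fpoly (nat * nat)%type A :=
  fmonom ((0, 1) : nat * nat).

Local Notation cst a := (fconst a : fpoly (nat * nat)%type A).

Record conformal_algebra star : Prop := {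
  conf_bilinear : bilinear_for *:%R *:%R star;
  conf_dl : forall a b, star (d a) b = - lam1 (star a b);
  conf_dr : forall a b, star a (d b) = fd (star a b) + lam1 (star a b)
}.

Record is_derivation star (D : {linear A -> A}) : Prop := {
  der_comm : forall a, D (d a) = d (D a);
  der_prod : forall a b,
    fmap_coef D (star a b) = star (D a) b + star a (D b)
}.

Record comm_assoc_conformal_algebra circ : Prop := {
  cac_conf : conformal_algebra circ;
  cac_assoc : forall a b c,
    lprod circ lam (cst a) (lprod circ mu (cst b) (cst c)) =
    lprod circ (lam \+ mu) (lprod circ lam (cst a) (cst b)) (cst c);
  cac_comm : forall a b, circ a b = fsubst neg_d_lam (circ b a)
}.

Record lie_conformal_algebra br : Prop := {
  lie_conf : conformal_algebra br;
  lie_skew : forall a b, br a b = - fsubst neg_d_lam (br b a);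
  lie_jacobi : forall a b c,
    lprod br lam (cst a) (lprod br mu (cst b) (cst c)) =
    lprod br (lam \+ mu) (lprod br lam (cst a) (cst b)) (cst c) +
    lprod br mu (cst b) (lprod br lam (cst a) (cst c))
}.

Record transposed_poisson_conformal_algebra circ br : Prop := {
  tpca_circ : comm_assoc_conformal_algebra circ;
  tpca_lie : lie_conformal_algebra br;
  tpca_leibniz : forall a b c,
    2%:R *: lprod circ lam (cst a) (lprod br mu (cst b) (cst c)) =
    lprod br (lam \+ mu) (lprod circ lam (cst a) (cst b)) (cst c) +
    lprod br mu (cst b) (lprod circ lam (cst a) (cst c))
}.

End Structures.

(* Main.v *)
Require Import Defs.
From HB Require Import structures.
From mathcomp Require Import all_boot all_order all_algebra.
From mathcomp Require Import finmap.
Local Open Scope ring_scope.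

Set Implicit Arguments.
Unset Strict Implicit.
Unset Printing Implicit Defensive.
Import GRing.Theory.

(** By commutativity, the second term of [a_lambda b] is D(a) o_lambda b, so
    the bracket is the Gelfand-Dorfman type expression
      [a_lambda b] = a o_lambda D(b) - D(a) o_lambda b.
    Every product occurring in the Jacobi and transposed Leibniz identities can
    then be brought to one of the standard forms
      T(x, y, z) = x o_lambda (y o_mu z):
    - associativity gives (x o_lambda y) o_(lambda+mu) z = T(x, y, z);
    - y o_mu (x o_lambda z) = T(x, y, z) too ([lprod_exchange]).  Associativity,
      with the names of lambda and mu exchanged, turns the left-hand side into
      (y o_mu x) o_(lambda+mu) z.  By commutativity y o_mu x is x o_(-d-mu) y,
      and since d acts on a left factor of o_(lambda+mu) as -(lambda+mu), the
      variable -d-mu becomes lambda there ([lprod_shift]).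
    As D is a derivation, D(x o y) = D(x) o y + x o D(y) also for products of
    polynomials ([lprod_derivation]).  Both identities thus become identities
    between the elements T(D^i a, D^j b, D^k c), in which everything cancels
    ([derivation_bracket_jacobi], [derivation_bracket_leibniz]).

    Operators on polynomials are treated as additive maps.  Two of them are
    compared on monomials only ([fpoly_ext]), where substitution and product
    have closed formulas ([fsubstU], [lprodU]). *)

(** * Additive maps on polynomials *)

Section Fsum.
Context (K : nmodType) (A B : zmodType).
Implicit Types (F : K -> {additive A -> B}) (p q : fpoly K A).

(** The additive map on polynomials with prescribed values on the monomials of
    each exponent; all operations on [fpoly] are instances of it. *)
Definition fsum F p : B := \sum_(k <- msupp p) F k p@_k.

(** Sums of different polynomials can only be combined over a common set of
    exponents; the extra terms vanish because each [F k] preserves 0. *)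
Lemma fsumEw F p (E : {fset K}) : (msupp p `<=` E)%fset ->
  fsum F p = \sum_(k <- E) F k p@_k.
Proof.
move=> sub; rewrite /fsum; apply: big_fset_incl => //= k _ kp.
by rewrite mcoeff_outdom // raddf0.
Qed.

Lemma fsum_is_additive F : zmod_morphism (fsum F).
Proof.
move=> p q; have sub := msuppB_le p q.
rewrite (fsumEw F sub) (fsumEw F (fsubsetUl (msupp p) (msupp q))).
rewrite (fsumEw F (fsubsetUr (msupp p) (msupp q))) -sumrB.
by apply: eq_bigr => k _; rewrite mcoeffB raddfB.
Qed.

HB.instance Definition _ F := GRing.isZmodMorphism.Build (fpoly K A) B (fsum F)
  (fsum_is_additive F).

Lemma fsumU F a k : fsum F << a *g k >> = F k a.
Proof. by rewrite (fsumEw F msuppU_le) big_seq_fset1 mcoeffUU. Qed.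

Lemma fpoly_ind (P : fpoly K A -> Prop) :
  (forall p q, P p -> P q -> P (p + q)) -> (forall a k, P << a *g k >>) ->
  forall p, P p.
Proof.
move=> PD PU p; rewrite [p]monalgE; elim/big_rec: _ => [|k q _ Pq].
  by rewrite -(monalgU0 (0 : K)); apply: PU.
by apply: PD.
Qed.

Lemma fpoly_ext (f g : {additive fpoly K A -> B}) :
  (forall a k, f << a *g k >> = g << a *g k >>) -> f =1 g.
Proof.
by move=> fg; apply: fpoly_ind => // p q fgp fgq; rewrite !raddfD fgp fgq.
Qed.
End Fsum.

Arguments fpoly_ext [K A B] f g _ _.

(** * Monomials, coefficients and substitution *)

Section Operations.
Context (K : nmodType) (A : zmodType).
Implicit Types (p q : fpoly K A) (f : {additive A -> A}) (k l : K).
Implicit Types (nu : {additive fpoly K A -> fpoly K A}).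

(** The monomial constructor with [fpoly] as codomain, so that its additivity is
    found by instance resolution. *)
Definition fpolyU k (a : A) : fpoly K A := << a *g k >>.

Lemma fpolyU_is_additive k : zmod_morphism (fpolyU k).
Proof. exact: monalgUB. Qed.
HB.instance Definition _ k :=
  GRing.isZmodMorphism.Build _ _ (fpolyU k) (fpolyU_is_additive k).

Lemma fmonom_is_additive k : zmod_morphism (@fmonom K A k).
Proof. exact: (fsum_is_additive (fun l => fpolyU (k + l))). Qed.
HB.instance Definition _ k :=
  GRing.isZmodMorphism.Build _ _ (@fmonom K A k) (fmonom_is_additive k).

Lemma fmonomU k a l : fmonom k << a *g l >> = << a *g (k + l : K) >> :> fpoly K A.
Proof. exact: (fsumU (fun l => fpolyU (k + l))). Qed.

Lemma fmap_coef_is_additive f : zmod_morphism (@fmap_coef K A f).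
Proof. exact: (fsum_is_additive (fun l => fpolyU l \o f)). Qed.
HB.instance Definition _ f :=
  GRing.isZmodMorphism.Build _ _ (@fmap_coef K A f) (fmap_coef_is_additive f).

Lemma fmap_coefU f a l : fmap_coef f << a *g l >> = << f a *g l >> :> fpoly K A.
Proof. exact: (fsumU (fun l => fpolyU l \o f)). Qed.

Lemma fconst_is_additive : zmod_morphism (@fconst K A).
Proof. by move=> a b; rewrite /fconst monalgUB. Qed.
HB.instance Definition _ :=
  GRing.isZmodMorphism.Build _ _ (@fconst K A) fconst_is_additive.

Lemma iter_is_additive nu n : zmod_morphism (iter n nu).
Proof. by elim: n => [|n IH] p q //=; rewrite IH raddfB. Qed.
HB.instance Definition _ nu n :=
  GRing.isZmodMorphism.Build _ _ (iter n nu) (iter_is_additive nu n).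

Lemma fsubst_is_additive nu : zmod_morphism (@fsubst K A nu).
Proof. exact: (fsum_is_additive (fun n => iter n nu \o fconst)). Qed.
HB.instance Definition _ nu :=
  GRing.isZmodMorphism.Build _ _ (@fsubst K A nu) (fsubst_is_additive nu).

Lemma fsubstU nu a n : fsubst nu << a *g n >> = iter n nu (fconst a).
Proof. exact: (fsumU (fun n => iter n nu \o fconst)). Qed.

Lemma fsubstD nu w w' : fsubst nu (w + w') = fsubst nu w + fsubst nu w'.
Proof. exact: raddfD. Qed.

Lemma fsubst_const nu a : fsubst nu (fconst a) = fconst a.
Proof. exact: fsubstU. Qed.

Lemma fmonom_comp k l p : fmonom (k + l) p = fmonom k (fmonom l p).
Proof.
elim/fpoly_ind: p => [p q IHp IHq|a m]; first by rewrite !raddfD /= IHp IHq.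
by rewrite !fmonomU addrA.
Qed.

Lemma fmonom0 p : fmonom 0 p = p.
Proof.
elim/fpoly_ind: p => [p q IHp IHq|a m]; first by rewrite !raddfD /= IHp IHq.
by rewrite !fmonomU add0r.
Qed.

Lemma fmonomD k p q : fmonom k (p + q) = fmonom k p + fmonom k q.
Proof. exact: raddfD. Qed.

Lemma fmap_coefD f p q : fmap_coef f (p + q) = fmap_coef f p + fmap_coef f q.
Proof. exact: raddfD. Qed.

Lemma fmap_coef_fmonom f k p :
  fmap_coef f (fmonom k p) = fmonom k (fmap_coef f p).
Proof.
elim/fpoly_ind: p => [p q IHp IHq|a m]; first by rewrite !raddfD /= IHp IHq.
by rewrite fmonomU !fmap_coefU fmonomU.
Qed.
End Operations.

(** * Renaming formal variables *)

Section Relabel.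
Context (A : zmodType) (K K' : nmodType) (h : {additive K -> K'}).
Implicit Types (p : fpoly K A).

Definition frelabel p : fpoly K' A := fsum (fun k => @fpolyU K' A (h k)) p.

Lemma frelabel_is_additive : zmod_morphism frelabel.
Proof. exact: fsum_is_additive. Qed.
HB.instance Definition _ :=
  GRing.isZmodMorphism.Build _ _ frelabel frelabel_is_additive.

Lemma frelabelD p q : frelabel (p + q) = frelabel p + frelabel q.
Proof. exact: raddfD. Qed.

Lemma frelabelU a k : frelabel << a *g k >> = << a *g (h k) >> :> fpoly K' A.
Proof. exact: fsumU. Qed.

Lemma frelabel_fconst a : frelabel (fconst a) = fconst a.
Proof. by rewrite frelabelU raddf0. Qed.

Lemma frelabel_fmonom k p : frelabel (fmonom k p) = fmonom (h k) (frelabel p).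
Proof.
elim/fpoly_ind: p => [p q IHp IHq|a m]; first by rewrite !raddfD /= IHp IHq.
by rewrite fmonomU !frelabelU fmonomU raddfD.
Qed.
End Relabel.

(** * Substitution and additive maps *)

Section Substitution.
Context (A : zmodType).
Implicit Types (K : nmodType) (w : fpoly nat A).

(** The value of w at nu only involves iterates of nu on constants, so a map that
    carries nu to nu' and constants to constants carries values to values. *)
Lemma fsubst_intertwine K K' (f : {additive A -> A})
    (s : {additive fpoly K A -> fpoly K' A})
    (nu : {additive fpoly K A -> fpoly K A})
    (nu' : {additive fpoly K' A -> fpoly K' A}) w :
  (forall a, s (fconst a) = fconst (f a)) ->
  (forall p, s (nu p) = nu' (s p)) ->
  s (fsubst nu w) = fsubst nu' (fmap_coef f w).
Proof.
move=> s_const s_nu.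
elim/fpoly_ind: w => [p q IHp IHq|a n]; first by rewrite !raddfD /= IHp IHq.
rewrite fmap_coefU !fsubstU -s_const.
by elim: n => //= n IH; rewrite s_nu IH.
Qed.

Lemma fmap_coef_fsubst K (f : {additive A -> A})
    (nu : {additive fpoly K A -> fpoly K A}) w :
  (forall p, fmap_coef f (nu p) = nu (fmap_coef f p)) ->
  fmap_coef f (fsubst nu w) = fsubst nu (fmap_coef f w).
Proof.
move=> f_nu; apply: (fsubst_intertwine (s := fmap_coef f)) => // a.
exact: fmap_coefU.
Qed.

Lemma fmap_coef_id K (p : fpoly K A) : fmap_coef idfun p = p.
Proof.
elim/fpoly_ind: p => [p q IHp IHq|a n]; first by rewrite raddfD /= IHp IHq.
by rewrite fmap_coefU.
Qed.

Lemma fsubst_lam1 K (nu : {additive fpoly K A -> fpoly K A}) w :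
  fsubst nu (fmonom (1 : nat) w) = nu (fsubst nu w).
Proof.
elim/fpoly_ind: w => [p q IHp IHq|a n]; first by rewrite !raddfD /= IHp IHq.
by rewrite fmonomU !fsubstU.
Qed.
End Substitution.

(** * The product of polynomials *)

Section LinearProduct.
Context (A : zmodType) (star : A -> A -> fpoly nat A).
Hypothesis starBl : forall b, zmod_morphism (star^~ b).
Hypothesis starBr : forall a, zmod_morphism (star a).

Let starl b : {additive A -> fpoly nat A} :=
  HB.pack (star^~ b) (GRing.isZmodMorphism.Build _ _ _ (starBl b)).
Let starr a : {additive A -> fpoly nat A} :=
  HB.pack (star a) (GRing.isZmodMorphism.Build _ _ _ (starBr a)).

Section Exponents.
Context (K : nmodType) (nu : {additive fpoly K A -> fpoly K A}).
Implicit Types p q : fpoly K A.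

Lemma lprodBr p : zmod_morphism (lprod star nu p).
Proof.
move=> q q'; rewrite /lprod -sumrB; apply: eq_bigr => k _.
exact: (fsum_is_additive (fun l => fmonom (k + l) \o (fsubst nu \o starr p@_k))).
Qed.

Lemma lprodBl q : zmod_morphism (lprod star nu ^~ q).
Proof.
move=> p p'; rewrite /lprod exchange_big /= [X in _ = X - _]exchange_big /=.
rewrite [X in _ = _ - X]exchange_big /= -sumrB.
apply: eq_bigr => l _.
exact: (fsum_is_additive (fun k => fmonom (k + l) \o (fsubst nu \o starl q@_l))).
Qed.

Definition lprodl q : {additive fpoly K A -> fpoly K A} :=
  HB.pack (lprod star nu ^~ q) (GRing.isZmodMorphism.Build _ _ _ (lprodBl q)).
Definition lprodr p : {additive fpoly K A -> fpoly K A} :=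
  HB.pack (lprod star nu p) (GRing.isZmodMorphism.Build _ _ _ (lprodBr p)).

Lemma lprodU a k b l :
  lprod star nu << a *g k >> << b *g l >> =
    fmonom (k + l) (fsubst nu (star a b)).
Proof.
rewrite /lprod.
transitivity
  (fsum (fun k => fmonom (k + l) \o (fsubst nu \o starl b)) << a *g k >>).
  apply: eq_bigr => m _.
  exact: (fsumU (fun l => fmonom (m + l) \o (fsubst nu \o starr _))).
by rewrite fsumU.
Qed.

Lemma lprod_fconst a b :
  lprod star nu (fconst a) (fconst b) = fsubst nu (star a b).
Proof. by rewrite lprodU addr0 fmonom0. Qed.

Lemma lprod_fmonoml k p q :
  lprod star nu (fmonom k p) q = fmonom k (lprod star nu p q).
Proof.
refine (fpoly_ext (lprodl q \o fmonom k) (fmonom k \o lprodl q) _ p).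
move=> a l.
refine (fpoly_ext (lprodr _) (fmonom k \o lprodr _) _ q); move=> b m /=.
by rewrite fmonomU !lprodU -fmonom_comp addrA.
Qed.

Lemma lprod_derivation (f : {additive A -> A}) :
  (forall a b, fmap_coef f (star a b) = star (f a) b + star a (f b)) ->
  (forall p, fmap_coef f (nu p) = nu (fmap_coef f p)) ->
  forall p q, fmap_coef f (lprod star nu p q) =
    lprod star nu (fmap_coef f p) q + lprod star nu p (fmap_coef f q).
Proof.
move=> f_star f_nu p q.
refine (fpoly_ext (fmap_coef f \o lprodl q)
  ((lprodl q \o fmap_coef f) \+ lprodl (fmap_coef f q)) _ p); move=> a k.
refine (fpoly_ext (fmap_coef f \o lprodr _)
  (lprodr _ \+ (lprodr _ \o fmap_coef f)) _ q); move=> b l /=.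
rewrite !fmap_coefU !lprodU fmap_coef_fmonom fmap_coef_fsubst //.
by rewrite f_star fsubstD fmonomD.
Qed.

(** The rule (d a) o_lambda b = - lambda (a o_lambda b) persists when lambda is
    replaced by nu and the factors by polynomials. *)
Lemma lprod_sesquilinearl (f : {additive A -> A}) :
  (forall a b, star (f a) b = - fmonom (1 : nat) (star a b)) ->
  (forall k p, nu (fmonom k p) = fmonom k (nu p)) ->
  forall p q, lprod star nu (fmap_coef f p) q = - nu (lprod star nu p q).
Proof.
move=> f_star nu_monom p q.
refine (fpoly_ext (lprodl q \o fmap_coef f) (\- (nu \o lprodl q)) _ p).
move=> a k.
refine (fpoly_ext (lprodr _) (\- (nu \o lprodr _)) _ q); move=> b l /=.
rewrite fmap_coefU !lprodU f_star raddfN /= fsubst_lam1 nu_monom.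
exact: raddfN.
Qed.
End Exponents.

Lemma frelabel_lprod (K K' : nmodType) (h : {additive K -> K'})
    (nu : {additive fpoly K A -> fpoly K A})
    (nu' : {additive fpoly K' A -> fpoly K' A}) :
  (forall p, frelabel h (nu p) = nu' (frelabel h p)) ->
  forall p q, frelabel h (lprod star nu p q) =
    lprod star nu' (frelabel h p) (frelabel h q).
Proof.
move=> h_nu p q.
refine (fpoly_ext (frelabel h \o lprodl nu q)
  (lprodl nu' (frelabel h q) \o frelabel h) _ p); move=> a k.
refine (fpoly_ext (frelabel h \o lprodr nu _)
  (lprodr nu' _ \o frelabel h) _ q); move=> b l /=.
rewrite !frelabelU !lprodU frelabel_fmonom raddfD; congr fmonom.
rewrite (fsubst_intertwine (f := idfun) (s := frelabel h) (nu' := nu')) //.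
  by rewrite fmap_coef_id.
exact: frelabel_fconst.
Qed.
End LinearProduct.

(** * Exchanging lambda and mu *)

Definition exchange_exp (k : nat * nat) : nat * nat := (k.2, k.1).

Lemma exchange_exp_is_additive : nmod_morphism exchange_exp.
Proof. by []. Qed.
HB.instance Definition _ :=
  GRing.isNmodMorphism.Build _ _ exchange_exp exchange_exp_is_additive.

Section FormalVariables.
Context (C : fieldType) (A : lmodType C).

HB.instance Definition _ := GRing.Additive.copy (@lam C A) (fmonom _).
HB.instance Definition _ := GRing.Additive.copy (@mu C A) (fmonom _).
HB.instance Definition _ (d : {linear A -> A}) K :=
  GRing.Additive.copy (@fd C A d K) (fmap_coef d).
HB.instance Definition _ (d : {linear A -> A}) :=
  GRing.Additive.copy (@neg_d_lam C A d) ((\- fd d) \- fmonom (1 : nat)).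
End FormalVariables.

Section CommAssocConformal.
Context (C : fieldType) (A : lmodType C) (d : {linear A -> A}).
Context (circ : A -> A -> fpoly nat A).
Hypothesis circ_cac : comm_assoc_conformal_algebra d circ.
Local Notation lam := (@lam C A).
Local Notation mu := (@mu C A).
Let circ_conf := cac_conf circ_cac.
Local Notation fpoly2 := (fpoly (nat * nat)%type A).
Local Notation cst a := (fconst a : fpoly2).
Implicit Types p q : fpoly2.

Lemma conf_Bl star : conformal_algebra d star ->
  forall b, zmod_morphism (star^~ b).
Proof. by case=> -[linl _] _ _ b; apply: zmod_morphism_linear (linl b). Qed.

Lemma conf_Br star : conformal_algebra d star ->
  forall a, zmod_morphism (star a).
Proof. by case=> -[_ linr] _ _ a; apply: zmod_morphism_linear (linr a). Qed.

(** Evaluating -d - lambda at lambda = nu. *)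
Lemma fsubst_neg_d_lam (nu : {additive fpoly2 -> fpoly2}) w :
  (forall p, fd d (nu p) = nu (fd d p)) ->
  fsubst nu (fsubst (neg_d_lam d) w) = fsubst ((\- fd d) \- nu) w.
Proof.
move=> d_nu; rewrite (fsubst_intertwine (f := idfun) (s := fsubst nu)
  (nu' := (\- fd d) \- nu)) ?fmap_coef_id // => [a|p].
  exact: fsubst_const.
rewrite /neg_d_lam /= /lam1 raddfB /= raddfN /= fsubst_lam1.
by rewrite -fmap_coef_fsubst.
Qed.

Lemma lam_fmonom k p : lam (fmonom k p) = fmonom k (lam p).
Proof. by rewrite /lam -!fmonom_comp addrC. Qed.

Lemma mu_fmonom k p : mu (fmonom k p) = fmonom k (mu p).
Proof. by rewrite /mu -!fmonom_comp addrC. Qed.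

Let Bl := conf_Bl circ_conf.
Let Br := conf_Br circ_conf.

(** On a left factor of the product at lambda + mu, d acts as -(lambda + mu);
    hence -d - mu acts there as lambda. *)
Lemma lprod_shift p q :
  lprod circ (lam \+ mu) (((\- fd d) \- mu) p) q =
  lam (lprod circ (lam \+ mu) p q).
Proof.
pose L := lprodl Bl (lam \+ mu) q.
have dL : L (fd d p) = - (lam \+ mu) (L p).
  apply: (lprod_sesquilinearl Bl Br (f := d)) => [x y|k r].
    exact: (conf_dl circ_conf).
  by rewrite /= lam_fmonom mu_fmonom fmonomD.
have muL : L (mu p) = mu (L p) by exact: lprod_fmonoml.
change (L (- fd d p - mu p) = lam (L p)).
by rewrite raddfB raddfN muL dL opprK addrK.
Qed.

Lemma lprod_fsubst_shift w q :
  lprod circ (lam \+ mu) (fsubst ((\- fd d) \- mu) w) q =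
  lprod circ (lam \+ mu) (fsubst lam w) q.
Proof.
refine (fpoly_ext (lprodl Bl (lam \+ mu) q \o fsubst ((\- fd d) \- mu))
  (lprodl Bl (lam \+ mu) q \o fsubst lam) _ w); move=> x n /=.
rewrite (fsubstU _ x n) (fsubstU lam x n); elim: n => [//|n IH].
rewrite [iter _ lam _]iterS.
transitivity (lam (lprod circ (lam \+ mu)
  (iter n ((\- fd d) \- mu) (fconst x)) q)); first exact: lprod_shift.
by rewrite IH; apply/esym/lprod_fmonoml.
Qed.

Lemma lprod_left_comm a b q :
  lprod circ (lam \+ mu) (lprod circ mu (cst b) (cst a)) q =
  lprod circ (lam \+ mu) (lprod circ lam (cst a) (cst b)) q.
Proof.
rewrite (lprod_fconst Bl Br _ b a) (lprod_fconst Bl Br _ a b).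
rewrite (cac_comm circ_cac b a) fsubst_neg_d_lam; last first.
  by move=> p; rewrite /fd /mu fmap_coef_fmonom.
exact: lprod_fsubst_shift.
Qed.

(** Associativity applies to both sides.  On the left it must be used with lambda
    and mu interchanged; it holds in that form because renaming the variables is
    compatible with products. *)
Lemma lprod_exchange a b c :
  lprod circ mu (cst b) (lprod circ lam (cst a) (cst c)) =
  lprod circ lam (cst a) (lprod circ mu (cst b) (cst c)).
Proof.
have rlam p : frelabel exchange_exp (lam p) = mu (frelabel exchange_exp p).
  exact: frelabel_fmonom.
have rmu p : frelabel exchange_exp (mu p) = lam (frelabel exchange_exp p).
  exact: frelabel_fmonom.
have rlammu p : frelabel exchange_exp ((lam \+ mu) p) =
    (lam \+ mu) (frelabel exchange_exp p).
  by rewrite /= frelabelD rlam rmu addrC.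
rewrite (cac_assoc circ_cac a b c) -lprod_left_comm.
have rc x : frelabel exchange_exp (cst x) = cst x by apply: frelabel_fconst.
have rlam2 x q : frelabel exchange_exp (lprod circ lam (cst x) q) =
    lprod circ mu (cst x) (frelabel exchange_exp q).
  by rewrite -[in RHS](rc x); apply: frelabel_lprod.
have rmu2 x q : frelabel exchange_exp (lprod circ mu (cst x) q) =
    lprod circ lam (cst x) (frelabel exchange_exp q).
  by rewrite -[in RHS](rc x); apply: frelabel_lprod.
have rlammu2 p x : frelabel exchange_exp (lprod circ (lam \+ mu) p (cst x)) =
    lprod circ (lam \+ mu) (frelabel exchange_exp p) (cst x).
  by rewrite -[in RHS](rc x); apply: frelabel_lprod.
transitivity (frelabel exchange_exp
    (lprod circ lam (cst b) (lprod circ mu (cst a) (cst c)))).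
  exact/esym/(etrans (rlam2 b _))/congr1/(etrans (rmu2 a _))/congr1/rc.
transitivity (frelabel exchange_exp
    (lprod circ (lam \+ mu) (lprod circ lam (cst b) (cst a)) (cst c))).
  exact/congr1/(cac_assoc circ_cac).
apply: (etrans (rlammu2 _ c)); congr (lprod _ _ _ _).
exact: etrans (rlam2 b (cst a)) (congr1 _ (rc a)).
Qed.

End CommAssocConformal.

(** * The bracket of a derivation on abstract triple products *)

(** In this section, [prl], [prm] and [prs] stand for the products at lambda, mu
    and lambda + mu, [delta] for the coefficientwise derivation and [cst] for the
    embedding of constants.  Only the rules for rewriting a triple product into
    the form [prl a (prm b c)] matter for the two identities, so they are proved
    from these rules alone. *)
Section DerivationBracket.
Context (N : Type) (V : zmodType) (D : N -> N) (delta : {additive V -> V}).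
Context (cst : N -> V) (prl prm prs : V -> V -> V).
Hypothesis delta_cst : forall a, delta (cst a) = cst (D a).
Hypothesis delta_prl : forall p q,
  delta (prl p q) = prl (delta p) q + prl p (delta q).
Hypothesis delta_prm : forall p q,
  delta (prm p q) = prm (delta p) q + prm p (delta q).
Hypothesis prlB : forall p, zmod_morphism (prl p).
Hypothesis prmB : forall p, zmod_morphism (prm p).
Hypothesis prsB : forall p, zmod_morphism (prs^~ p).
Hypothesis assoc : forall a b c,
  prs (prl (cst a) (cst b)) (cst c) = prl (cst a) (prm (cst b) (cst c)).
Hypothesis exchange : forall a b c,
  prm (cst b) (prl (cst a) (cst c)) = prl (cst a) (prm (cst b) (cst c)).

Definition derivation_bracket (pr : V -> V -> V) p q :=
  pr p (delta q) - pr (delta p) q.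
Local Notation br := derivation_bracket.

Let bundle (f : V -> V) (fB : zmod_morphism f) : {additive V -> V} :=
  HB.pack f (GRing.isZmodMorphism.Build V V f fB).

Let prlD p q q' : prl p (q + q') = prl p q + prl p q'.
Proof. exact: (raddfD (bundle (prlB p))). Qed.
Let prmD p q q' : prm p (q + q') = prm p q + prm p q'.
Proof. exact: (raddfD (bundle (prmB p))). Qed.
Let prsD p p' q : prs (p + p') q = prs p q + prs p' q.
Proof. exact: (raddfD (bundle (prsB q))). Qed.
Let prlN p q : prl p (- q) = - prl p q.
Proof. exact: (raddfN (bundle (prlB p))). Qed.
Let prmN p q : prm p (- q) = - prm p q.
Proof. exact: (raddfN (bundle (prmB p))). Qed.
Let prsN p q : prs (- p) q = - prs p q.
Proof. exact: (raddfN (bundle (prsB q))). Qed.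
Let distr := (prlD, prmD, prsD, prlN, prmN, prsN).

Lemma derivation_bracket_jacobi a b c :
  br prl (cst a) (br prm (cst b) (cst c)) =
  br prs (br prl (cst a) (cst b)) (cst c) +
  br prm (cst b) (br prl (cst a) (cst c)).
Proof.
rewrite /derivation_bracket !delta_cst.
rewrite !(raddfB delta) !delta_prl !delta_prm !delta_cst.
rewrite !(opprD, distr, opprK) !assoc !exchange.
(* On the left only T(a, Db, Dc) cancels; on the right the pairs brought to the
   front are T(a, Db, Dc), T(Da, Db, c), T(DDa, b, c) and T(Da, b, Dc). *)
rewrite [LHS](AC (2*2*2) ((1*4)*2*3*(5*6))).
rewrite [RHS](AC ((2*(2*2))*(2*2*2)) ((1*11)*(6*3)*(5*9)*(7*2)*8*4*(10*12))).
by rewrite /= !subrr !add0r.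
Qed.

Lemma derivation_bracket_leibniz a b c :
  prl (cst a) (br prm (cst b) (cst c)) *+ 2 =
  br prs (prl (cst a) (cst b)) (cst c) +
  br prm (cst b) (prl (cst a) (cst c)).
Proof.
rewrite /derivation_bracket !delta_cst !delta_prl !delta_cst.
rewrite !(opprD, distr, opprK) !assoc !exchange.
rewrite mulr2n [RHS](AC ((1*2)*(2*1)) ((1*3)*(5*6)*(4*2))).
by rewrite /= [X in _ = _ + X]subrr addr0.
Qed.
End DerivationBracket.

(** * The transposed Poisson structure *)

Section BracketProduct.
Context (A : zmodType) (circ br : A -> A -> fpoly nat A) (D : {additive A -> A}).
Hypothesis circBl : forall b, zmod_morphism (circ^~ b).
Hypothesis circBr : forall a, zmod_morphism (circ a).
Hypothesis brE : forall a b, br a b = circ a (D b) - circ (D a) b.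

(** The formula for the bracket extends to polynomials: this identifies products
    in [br] with the abstract [derivation_bracket]. *)
Lemma lprod_bracket (K : nmodType) (nu : {additive fpoly K A -> fpoly K A}) p q :
  lprod br nu p q = derivation_bracket (fmap_coef D) (lprod circ nu) p q.
Proof.
have brBl b : zmod_morphism (br^~ b).
  move=> x y; rewrite !brE raddfB /= (circBl (D b)) (circBl b).
  by rewrite !opprB addrACA [RHS]addrACA; congr (_ + _); rewrite addrC.
have brBr a : zmod_morphism (br a).
  move=> x y; rewrite !brE raddfB /= (circBr a) (circBr (D a)).
  by rewrite !opprB addrACA [RHS]addrACA; congr (_ + _); rewrite addrC.
refine (fpoly_ext (lprodl brBl nu q) ((lprodl circBl nu (fmap_coef D q)) \-
  (lprodl circBl nu q \o fmap_coef D)) _ p); move=> a k.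
refine (fpoly_ext (lprodr brBr nu << a *g k >>)
  ((lprodr circBr nu << a *g k >> \o fmap_coef D) \-
   lprodr circBr nu (fmap_coef D << a *g k >>)) _ q); move=> b l /=.
rewrite !fmap_coefU (lprodU brBl brBr) !(lprodU circBl circBr) brE.
by rewrite !raddfB.
Qed.
End BracketProduct.

Section TransposedPoisson.
Context (C : fieldType) (A : lmodType C) (d D : {linear A -> A}).
Context (circ br : A -> A -> fpoly nat A).
Hypothesis circ_cac : comm_assoc_conformal_algebra d circ.
Hypothesis D_der : is_derivation d circ D.
Hypothesis brE : forall a b, br a b = circ a (D b) - circ (D a) b.
Let circ_conf := cac_conf circ_cac.
Let Bl := conf_Bl circ_conf.
Let Br := conf_Br circ_conf.

Lemma bracket_conformal : conformal_algebra d br.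
Proof.
have [[linl linr] dl dr] := circ_conf.
have linlE c x y b : circ (c *: x + y) b = c *: circ x b + circ y b.
  exact: linl.
have linrE c x y b : circ b (c *: x + y) = c *: circ b x + circ b y.
  exact: linr.
split.
- split=> b c x y /=; rewrite !brE linearP /=.
    by rewrite !linlE scalerBr opprD addrACA.
  by rewrite !linrE scalerBr opprD addrACA.
- move=> a b; rewrite !brE (der_comm D_der) !dl.
  by rewrite /lam1 (raddfB (@fmonom nat A (1 : nat))) opprD.
- move=> a b; rewrite !brE (der_comm D_der) !dr.
  rewrite /lam1 /fd (raddfB (@fmonom nat A (1 : nat))).
  rewrite (raddfB (@fmap_coef nat A d)).
  by rewrite opprD addrACA.
Qed.

Lemma bracket_skew a b : br a b = - fsubst (neg_d_lam d) (br b a).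
Proof.
rewrite !brE (raddfB (fsubst (neg_d_lam d))) /=.
by rewrite -!(cac_comm circ_cac) opprB.
Qed.

Let delta : {additive fpoly (nat * nat)%type A -> fpoly (nat * nat)%type A} :=
  fmap_coef D.
Local Notation lam := (@lam C A).
Local Notation mu := (@mu C A).
Local Notation cst a := (fconst a : fpoly (nat * nat)%type A).

Let delta_lprod
    (nu : {additive fpoly (nat * nat)%type A -> fpoly (nat * nat)%type A}) :
  (forall p, delta (nu p) = nu (delta p)) ->
  forall p q, delta (lprod circ nu p q) =
    lprod circ nu (delta p) q + lprod circ nu p (delta q).
Proof. exact/lprod_derivation/(der_prod D_der). Qed.

Let delta_lam := delta_lprod (nu := lam) (fmap_coef_fmonom D _).
Let delta_mu := delta_lprod (nu := mu) (fmap_coef_fmonom D _).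
Let delta_cst a : delta (cst a) = cst (D a).
Proof. exact: fmap_coefU. Qed.

Let brP := lprod_bracket Bl Br brE.

Lemma bracket_jacobi a b c :
  lprod br lam (cst a) (lprod br mu (cst b) (cst c)) =
  lprod br (lam \+ mu) (lprod br lam (cst a) (cst b)) (cst c) +
  lprod br mu (cst b) (lprod br lam (cst a) (cst c)).
Proof.
rewrite (brP lam (cst a) (cst b)) (brP lam (cst a) (cst c)).
rewrite (brP mu (cst b) (cst c)) (brP lam (cst a)) (brP mu (cst b)).
rewrite (brP (lam \+ mu)).
apply: (derivation_bracket_jacobi (D := D) delta_cst delta_lam delta_mu).
- by move=> p; apply: lprodBr.
- by move=> p; apply: lprodBr.
- by move=> p; apply: lprodBl.
- by move=> x y z; rewrite -(cac_assoc circ_cac).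
- by move=> x y z; apply: (lprod_exchange circ_cac).
Qed.

Lemma bracket_transposed_leibniz a b c :
  2%:R *: lprod circ lam (cst a) (lprod br mu (cst b) (cst c)) =
  lprod br (lam \+ mu) (lprod circ lam (cst a) (cst b)) (cst c) +
  lprod br mu (cst b) (lprod circ lam (cst a) (cst c)).
Proof.
rewrite scaler_nat.
rewrite (brP mu (cst b) (cst c)) (brP mu (cst b)) (brP (lam \+ mu)).
apply: (derivation_bracket_leibniz (D := D) delta_cst delta_lam).
- by move=> p; apply: lprodBr.
- by move=> p; apply: lprodBr.
- by move=> p; apply: lprodBl.
- by move=> x y z; rewrite -(cac_assoc circ_cac).
- by move=> x y z; apply: (lprod_exchange circ_cac).
Qed.
End TransposedPoisson.

Theorem corollary4p6 (R : realType) (N : lmodType R[i])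
    (d : {linear N -> N}) (circ : N -> N -> fpoly nat N)
    (D : {linear N -> N}) :
  comm_assoc_conformal_algebra d circ ->
  is_derivation d circ D ->
  transposed_poisson_conformal_algebra d circ
    (fun a b => circ a (D b) - fsubst (neg_d_lam d) (circ b (D a))).
Proof.
move=> circ_cac D_der; set br := fun a b => _.
have brE a b : br a b = circ a (D b) - circ (D a) b.
  by rewrite /br -(cac_comm circ_cac).
split; first exact: circ_cac.
  split.
  - exact: bracket_conformal circ_cac D_der brE.
  - exact: bracket_skew circ_cac brE.
  - exact: bracket_jacobi circ_cac D_der brE.
exact: bracket_transposed_leibniz circ_cac D_der brE.
Qed.
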